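(* Let $d\ge1$, let $\mathbf v_1<\mathbf v_2<\dots<\mathbf v_k$ be a strictly increasing chain in $\square^d=\{0,1\}^d$ (coordinatewise order), let $n_1,\dots,n_k\ge1$ be integers with $\sum_{i=1}^k n_i=d+1$, and let $C_\sigma=C_{\mathbf v_1}^{n_1}\cdots C_{\mathbf v_k}^{n_k}\in\mathrm{Chow}_{\mathrm{GS}}^{d+1}(\square^d)$. One of the two following cases can happen. 1. If there exists $1\le i<k$ such that $n_1+\dots+n_i>|\mathbf v_{i+1}|$, then $C_\sigma=0$. Similarly, if there exists $2\le i\le k$ such that $n_i+\dots+n_k>d-|\mathbf v_{i-1}|$, then $C_\sigma=0$. 2. Otherwise, there exists a sequence of integers $y_0,x_1,y_1,x_2,y_2,\dots,x_{k-1},y_{k-1},x_k$ such that - $|\mathbf v_1|=y_0$; - $|\mathbf v_i|=|\mathbf v_{i-1}|+x_{i-1}+y_{i-1}+1$ for all $i=2,\dots,k$; - $n_i=y_{i-1}+x_i+1$ for all $i=1,\dots,k$; and in this case $$\deg(C_\sigma)=(-1)^{d+1-k}\binom{y_0+x_1}{y_0}\binom{x_1+y_1}{x_1}\binom{y_1+x_2}{y_1}\cdots\binom{x_{k-1}+y_{k-1}}{y_{k-1}}\binom{y_{k-1}+x_k}{x_k}.$$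
   Context: For $\mathbf v\in\square^d=\{0,1\}^d$, $|\mathbf v|$ denotes the number of coordinates of $\mathbf v$ equal to 1. $\square^d$ is partially ordered coordinatewise. A (possibly degenerate) simplex of $\square^d$ is a weakly increasing sequence of elements; it is non-degenerate if strictly increasing. Thus (possibly repeated) vertices form a simplex iff they are pairwise comparable. $\mathrm{Chow}_{\mathrm{GS}}(\square^d)$ is the quotient of the graded ring $\mathbb Z[C_{\mathbf v}\mid\mathbf v\in\square^d]$ ($\deg C_{\mathbf v}=1$) by the ideal generated by: (R1) $C_{\mathbf v_1}\cdots C_{\mathbf v_m}$ whenever $\mathbf v_1,\dots,\mathbf v_m$ do not form a simplex; (R2) $C_{\mathbf u}\sum_{\mathbf v\in\square^d}C_{\mathbf v}$ for $\mathbf u\in\square^d$; (R3) $C_{\mathbf u}C_{\mathbf w}\sum_{\mathbf v\in\square^d:\,v_i=u_i}C_{\mathbf v}$ for $\mathbf u,\mathbf w\in\square^d$ and $1\le i\le d$ with $u_i\ne w_i$. The superscript $d+1$ denotes the graded piece of degree $d+1$. All products $\prod_{\mathbf v\in\tau}C_{\mathbf v}$, for $\tau$ a non-degenerate $d$-simplex (a maximal chain) of $\square^d$, are equal in $\mathrm{Chow}_{\mathrm{GS}}^{d+1}(\square^d)$, and this group is infinite cyclic generated by their common value. The degree map $\deg:\mathrm{Chow}_{\mathrm{GS}}^{d+1}(\square^d)\to\mathbb Z$ is the isomorphism sending this common value to $1$. *)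

(* Defs.v *)
From HB Require Import structures.
From mathcomp Require Import all_boot all_order all_algebra.
From mathcomp Require Import ring_quotient mpoly.
From mathcomp Require boolp.

Set Implicit Arguments.
Unset Strict Implicit.
Unset Printing Implicit Defensive.

Import GRing.Theory.
Local Open Scope ring_scope.
Local Open Scope quotient_scope.

Definition vertex (d : nat) := {ffun 'I_d -> bool}.

Definition vabs d (v : vertex d) : nat := #|[set i | v i]|.

Definition vle d : rel (vertex d) := fun u v => [forall i, u i ==> v i].

Definition vlt d : rel (vertex d) := fun u v => (u != v) && vle u v.

Definition forms_simplex d (s : seq (vertex d)) : Prop :=
  exists2 t, perm_eq t s & sorted (@vle d) t.

Definition nondeg_simplex d (m : nat) (t : seq (vertex d)) : bool :=
  (size t == m.+1) && sorted (@vlt d) t.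

(* The variables of [mpoly] are numbered, so the vertices are numbered by
   [enum_rank]. *)
Definition cpoly (d : nat) := {mpoly int[#|{: vertex d}|]}.

Definition cvar d (v : vertex d) : cpoly d := 'X_(enum_rank v).

Inductive chow_rel (d : nat) : cpoly d -> Prop :=
| ChowR1 (s : seq (vertex d)) :
    ~ forms_simplex s -> chow_rel (\prod_(v <- s) cvar v)
| ChowR2 (u : vertex d) :
    chow_rel (cvar u * \sum_(v : vertex d) cvar v)
| ChowR3 (u w : vertex d) (i : 'I_d) :
    u i != w i ->
    chow_rel (cvar u * cvar w * \sum_(v : vertex d | v i == u i) cvar v).

Definition generated_ideal (R : comNzRingType) (G : R -> Prop) (p : R) : Prop :=
  exists2 s : seq (R * R),
    forall a, a \in s -> G a.2 & p = \sum_(a <- s) a.1 * a.2.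

(* [{ideal_quot _}] expects a boolean predicate. *)
Definition chow_ideal (d : nat) : {pred cpoly d} :=
  fun p => boolp.asbool (generated_ideal (@chow_rel d) p).

Lemma chow_rel_eval0 d (p : cpoly d) : chow_rel p -> p.@[fun=> 0] = 0.
Proof.
case=> [s|u|u w i _]; rewrite ?mevalM ?mevalXU ?mul0r //.
case: s => [|v s] H; first by case: H; exists [::].
by rewrite big_cons mevalM mevalXU mul0r.
Qed.

Lemma chow_ideal_closed d : idealr_closed (@chow_ideal d).
Proof.
split.
- by apply/boolp.asboolP; exists [::]; rewrite ?big_nil.
- apply/negP => /boolp.asboolP[s sG /(congr1 (meval (fun=> 0)))].
  rewrite meval1 raddf_sum big_seq big1 => [/eqP|a /sG aG] //=.
  by rewrite mevalM (chow_rel_eval0 aG) mulr0.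
- move=> a p q /boolp.asboolP[s sG ->] /boolp.asboolP[t tG ->].
  apply/boolp.asboolP; exists ([seq (a * b.1, b.2) | b <- s] ++ t).
    by move=> b; rewrite mem_cat => /orP[/mapP[c /sG cG ->]|/tG].
  rewrite big_cat big_map mulr_sumr; congr (_ + _).
  by apply: eq_bigr => b _; rewrite mulrA.
Qed.

HB.instance Definition _ d :=
  isIdealr.Build (cpoly d) (@chow_ideal d) (@chow_ideal_closed d).

Definition chow (d : nat) : comNzRingType := {ideal_quot (@chow_ideal d)}.

Definition chow_pi d (p : cpoly d) : chow d := \pi_{ideal_quot (@chow_ideal d)} p.

Definition chowC d (v : vertex d) : chow d := chow_pi (cvar v).

Definition chow_piece (d m : nat) (x : chow d) : Prop :=
  exists2 p : cpoly d, p \is m.-homog & x = chow_pi p.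

(* The degree map lives on the graded piece of degree d+1; it is represented by
   a function on the whole ring, of which only the values there matter.  The
   first three fields say that it is a group isomorphism onto the integers. *)
Record is_degree_map (d : nat) (deg : chow d -> int) : Prop := IsDegreeMap {
  deg_add : forall x y : chow d, chow_piece d.+1 x -> chow_piece d.+1 y ->
    deg (x + y) = deg x + deg y;
  deg_inj : forall x y : chow d, chow_piece d.+1 x -> chow_piece d.+1 y ->
    deg x = deg y -> x = y;
  deg_surj : forall z : int, exists2 x : chow d, chow_piece d.+1 x & deg x = z;
  deg_maxchain : forall t : seq (vertex d), nondeg_simplex d t ->
    deg (\prod_(v <- t) chowC v) = 1
}.

(* Main.v *)
Require Import Defs.
From mathcomp Require Import all_boot all_order all_algebra.
From mathcomp Require Import ring_quotient mpoly zify ring.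
From mathcomp Require boolp.

Set Implicit Arguments.
Unset Strict Implicit.
Unset Printing Implicit Defensive.

Import GRing.Theory.
Local Open Scope ring_scope.

(* Let [u] be a vertex of the chain with exponent at least 2, [M] the monomial
   with one factor [C_u] removed, [p < u < q] the neighbours of [u].  Choosing
   coordinates [c], [c'] that separate [p] from [u] and [u] from [q], the
   relations (R3) for [c] and [c'] minus the relation (R2) leave
     C_u M = - (sum of the C_v M with p < v < u, v_c = 1,
                and with u < v < q, v_c' = 0),
   where at the ends of the chain (R2) replaces the missing (R3).  Iterating
   writes a monomial, up to sign, as a sum of maximal chains.  Their number obeys
   the same recursion as the product of binomials: among the inserted [v] only
   those of one specific rank contribute on each side of [u], and the two
   contributions add up by Pascal's rule.  Vanishing is the case of an empty sum. *)


(** * The quotient map onto the Chow ring *)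

Lemma chow_piM d (p q : cpoly d) : chow_pi (p * q) = chow_pi p * chow_pi q.
Proof. by rewrite /chow_pi rmorphM. Qed.

Lemma chow_piD d (p q : cpoly d) : chow_pi (p + q) = chow_pi p + chow_pi q.
Proof. by rewrite /chow_pi rmorphD. Qed.

Lemma chow_piN d (p : cpoly d) : chow_pi (- p) = - chow_pi p.
Proof. by rewrite /chow_pi rmorphN. Qed.

Lemma chow_pi0 d : chow_pi (0 : cpoly d) = 0.
Proof. by rewrite /chow_pi rmorph0. Qed.

Lemma chow_pi_sum d (I : finType) (P : pred I) (F : I -> cpoly d) :
  chow_pi (\sum_(i | P i) F i) = \sum_(i | P i) chow_pi (F i).
Proof. by rewrite /chow_pi rmorph_sum. Qed.

Lemma chow_pi_prod d (I : Type) (s : seq I) (F : I -> cpoly d) :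
  chow_pi (\prod_(i <- s) F i) = \prod_(i <- s) chow_pi (F i).
Proof. by rewrite /chow_pi rmorph_prod. Qed.

Lemma chow_pi_rel d (p : cpoly d) : chow_rel p -> chow_pi p = 0.
Proof.
move=> rel_p; rewrite -chow_pi0; apply/eqP.
rewrite -Quotient.idealrBE subr0; apply/boolp.asboolP.
exists [:: (1, p)]; last by rewrite big_seq1 mul1r.
by move=> a; rewrite inE => /eqP->.
Qed.

(** * The order on the cube and counting in its intervals *)

Section Vertices.
Variable d : nat.
Implicit Types u v w : vertex d.

Lemma vleP u v : reflect (forall i, u i -> v i) (vle u v).
Proof. by apply: (iffP forallP) => H i; [apply/implyP|apply/implyP/H]. Qed.

Lemma vle_refl u : vle u u.
Proof. exact/vleP. Qed.

Lemma vle_trans : transitive (@vle d).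
Proof. by move=> v u w /vleP uv /vleP vw; apply/vleP => i /uv /vw. Qed.

Lemma vle_anti u v : vle u v -> vle v u -> u = v.
Proof.
move=> /vleP uv /vleP vu; apply/ffunP => i.
by apply/idP/idP => [/uv|/vu].
Qed.

Lemma vltW u v : vlt u v -> vle u v.
Proof. by case/andP. Qed.

Lemma vltE u v : vlt u v = vle u v && ~~ vle v u.
Proof.
apply/andP/andP => [[neq uv]|[uv nvu]]; split=> //.
  by apply: contra neq => vu; apply/eqP/vle_anti.
by apply: contra nvu => /eqP->; apply: vle_refl.
Qed.

Lemma vlt_coord u v : vlt u v -> exists2 i, ~~ u i & v i.
Proof.
rewrite vltE => /andP[_]; rewrite negb_forall => /existsP[i].
by rewrite negb_imply => /andP[]; exists i.
Qed.

Lemma vabs_le u v : vle u v -> (vabs u <= vabs v)%N.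
Proof.
by move=> /vleP uv; apply/subset_leq_card/subsetP => i; rewrite !inE => /uv.
Qed.

Lemma vabs_lt u v : vlt u v -> (vabs u < vabs v)%N.
Proof.
move=> uv; have [i ui vi] := vlt_coord uv; apply/proper_card/properP.
split; first by apply/subsetP => j; rewrite !inE; apply/vleP/vltW.
by exists i; rewrite inE.
Qed.

Lemma vabs_max u : (vabs u <= d)%N.
Proof. by rewrite -[X in (_ <= X)%N]card_ord max_card. Qed.

(** The interval is parametrised by the subsets of the difference of the two supports, each added to
    the support of [u]. *)
Lemma card_vle_interval u w (k : nat) : vle u w ->
  #|[set v | [&& vle u v, vle v w & vabs v == (vabs u + k)%N]]|
    = 'C(vabs w - vabs u, k).
Proof.
move=> /vleP uw.
set U := [set i | u i]; set W := [set i | w i].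
have <- : #|W :\: U| = (vabs w - vabs u)%N.
  rewrite cardsD (_ : W :&: U = U) //; apply/setP => i.
  by rewrite !inE andbC; case: (boolP (u i)) => // /uw.
rewrite -cards_draws.
pose f (A : {set 'I_d}) : vertex d := [ffun i => (i \in A) || u i].
have f_abs (A : {set 'I_d}) : A \subset W :\: U -> vabs (f A) = (vabs u + #|A|)%N.
  move=> /subsetP sA; rewrite addnC -cardsUI (_ : A :&: U = set0).
    by rewrite cards0 addn0; apply: eq_card => i; rewrite !inE ffunE.
  by apply/setP => i; rewrite !inE; apply/negP => /andP[/sA]; rewrite !inE => /andP[/negP].
rewrite -(card_in_imset (f := f)); last first.
  move=> A B; rewrite !inE => /andP[/subsetP sA _] /andP[/subsetP sB _] eqf.
  apply/setP => i; move/ffunP/(_ i): eqf; rewrite !ffunE.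
  case: (boolP (u i)) => [ui _|]; last by rewrite !orbF.
  by apply/idP/idP => [/sA|/sB]; rewrite !inE ui.
apply: eq_card => v; rewrite inE; apply/idP/imsetP => [|[A]]; last first.
  rewrite inE => /andP[sA /eqP cA] ->; rewrite f_abs // cA eqxx andbT.
  apply/andP; split; apply/vleP => i; rewrite ffunE; first by move->; rewrite orbT.
  by case/orP => [/(subsetP sA)|/uw //]; rewrite !inE => /andP[].
case/and3P=> /vleP uv /vleP vw /eqP cv.
have sA : [set i | v i] :\: U \subset W :\: U.
  by apply/setSD/subsetP => i; rewrite !inE => /vw.
have fA : v = f ([set i | v i] :\: U).
  by apply/ffunP => i; rewrite !(inE, ffunE); case: (boolP (u i)) => // [/uv|_];
    rewrite ?orbF.
exists ([set i | v i] :\: U) => //; rewrite inE sA /=.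
by rewrite -(eqn_add2l (vabs u)) -f_abs // -fA cv.
Qed.

(** The guard corrects the binomial at both ends: truncated subtraction would give 1 for [s] below
    the rank of [p], and at the rank of [u] the only candidate is [u] itself, which [vlt]
    excludes. *)
Lemma card_below p u s : vle p u ->
  #|[set v | [&& vle p v, vlt v u & vabs v == s]]|
    = ((vabs p <= s < vabs u)%N * 'C(vabs u - vabs p, s - vabs p))%N.
Proof.
move=> pu; case: (leqP (vabs p) s) => [ps|sp]; last first.
  rewrite mul0n; apply/eqP; rewrite cards_eq0; apply/eqP/setP => v.
  rewrite !inE; apply/negP => /and3P[/vabs_le + _ /eqP].
  by move=> + eqs; rewrite eqs leqNgt sp.
case: (ltnP s (vabs u)) => [su|us] /=; last first.
  rewrite mul0n; apply/eqP; rewrite cards_eq0; apply/eqP/setP => v.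
  rewrite !inE; apply/negP => /and3P[_ /vabs_lt + /eqP].
  by move=> + eqs; rewrite eqs ltnNge us.
rewrite mul1n -card_vle_interval // subnKC //; apply: eq_card => v.
rewrite !inE vltE; case: eqP => [vs|]; last by rewrite !andbF.
rewrite !andbT; congr (_ && _); case: (boolP (vle v u)) => //= _.
by apply/negP => /vabs_le; rewrite vs leqNgt su.
Qed.

Lemma card_above u q s : vle u q -> (vabs u < s)%N ->
  #|[set v | [&& vlt u v, vle v q & vabs v == s]]|
    = 'C(vabs q - vabs u, s - vabs u).
Proof.
move=> uq us; rewrite -card_vle_interval // subnKC; last exact: ltnW.
apply: eq_card => v; rewrite !inE vltE.
case: eqP => [vs|]; last by rewrite !andbF.
rewrite !andbT; congr (_ && _); case: (boolP (vle u v)) => //= _.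
by apply/negP => /vabs_le; rewrite vs leqNgt us.
Qed.

End Vertices.


(** * Monomials and the linear relations between them *)

Section Monomials.
Variable d : nat.
Implicit Types (u v w : vertex d) (l pre post : seq (vertex d * nat)).

Lemma chowC_incomparable u v :
  ~~ vle u v -> ~~ vle v u -> chowC u * chowC v = 0.
Proof.
move=> uv vu; rewrite -chow_piM -(chow_pi_rel (ChowR1 (s := [:: u; v]) _)).
  by rewrite big_cons big_seq1.
case=> [[|x [|y [|z t]]]] peq; try by move/perm_size: peq.
rewrite /= andbT => xy.
have /orP[/eqP eqx|/eqP eqx] : (u == x) || (u == y).
- by have := perm_mem peq u; rewrite !inE eqxx /= => /esym <-.
- move: peq; rewrite eqx perm_cons => /perm_mem/(_ v).
  rewrite !inE eqxx => /eqP eqv.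
  by move: uv; rewrite eqx eqv xy.
- move: peq; rewrite -[[:: x; y]]/([:: x] ++ [:: y]) perm_catC /= eqx perm_cons.
  move=> /perm_mem/(_ v); rewrite !inE eqxx => /eqP eqv.
  by move: vu; rewrite eqx eqv xy.
Qed.

Lemma chowC_sum u : chowC u * \sum_v chowC v = 0.
Proof. by rewrite -chow_pi_sum -chow_piM (chow_pi_rel (ChowR2 _)). Qed.

(** Exchanging [u] and [w] in (R3) gives the other value of the coordinate, so both values of [b]
    are covered. *)
Lemma chowC_coord_sum u w i b : u i != w i ->
  chowC u * chowC w * \sum_(v : vertex d | v i == b) chowC v = 0.
Proof.
move=> neq; have [<-|ub] := eqVneq (u i) b.
  by rewrite -chow_pi_sum -!chow_piM (chow_pi_rel (ChowR3 neq)).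
have <- : w i = b by case: (u i) (w i) b neq ub => [] [] [].
rewrite eq_sym in neq.
by rewrite (mulrC (chowC u)) -chow_pi_sum -!chow_piM (chow_pi_rel (ChowR3 neq)).
Qed.

(* An entry [(v, e)] stands for the factor [C_v ^ (e + 1)], so that exponents
   are automatically positive. *)
Definition mon l : chow d := \prod_(a <- l) chowC a.1 ^+ a.2.+1.

Definition verts l := [seq a.1 | a <- l].

Definition chain l := sorted (@vlt d) (verts l).

Lemma mon_cons a l : mon (a :: l) = chowC a.1 ^+ a.2.+1 * mon l.
Proof. exact: big_cons. Qed.

Lemma mon_cat l1 l2 : mon (l1 ++ l2) = mon l1 * mon l2.
Proof. exact: big_cat. Qed.

Lemma mon_insert pre v post :
  chowC v * mon (pre ++ post) = mon (pre ++ (v, 0%N) :: post).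
Proof. by rewrite !mon_cat mon_cons expr1 mulrCA. Qed.

Lemma mon_dvd l u : u \in verts l -> exists N, mon l = chowC u * N.
Proof.
case/mapP=> [[x e] xl ->]; rewrite /mon (big_rem (x, e)) //= exprS -mulrA.
by eexists.
Qed.

Lemma mon_dvd2 l u w : u \in verts l -> w \in verts l -> u != w ->
  exists N, mon l = chowC u * chowC w * N.
Proof.
case/mapP=> [[x e] xl ->] wl neq; rewrite /mon (big_rem (x, e)) //= -/(mon _).
have [|N ->] := @mon_dvd (rem (x, e) l) w.
  case/mapP: wl neq => [[y f] yl ->] /= neq.
  apply: (map_f fst (x := (y, f))).
  move: yl; rewrite (perm_mem (perm_to_rem xl)) inE => /orP[] // /eqP[eqy _].
  by rewrite eqy eqxx in neq.
by exists (chowC x ^+ e * N); rewrite exprS mulrACA.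
Qed.

Lemma mon_incomparable l u v : u \in verts l -> ~~ vle u v -> ~~ vle v u ->
  chowC v * mon l = 0.
Proof.
move=> /mon_dvd[N ->] uv vu.
by rewrite mulrA [chowC v * _]mulrC chowC_incomparable ?mul0r.
Qed.

Lemma mon_sum l u : u \in verts l -> \sum_v chowC v * mon l = 0.
Proof.
move=> /mon_dvd[N ->]; rewrite -mulr_suml mulrA [X in X * N]mulrC.
by rewrite chowC_sum mul0r.
Qed.

Lemma mon_coord_sum l u w i b : u \in verts l -> w \in verts l -> u i != w i ->
  \sum_(v : vertex d | v i == b) chowC v * mon l = 0.
Proof.
move=> ul wl neq; have [|N ->] := mon_dvd2 ul wl.
  by apply: contra neq => /eqP->.
by rewrite -mulr_suml mulrA [X in X * N]mulrC chowC_coord_sum // mul0r.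
Qed.

Lemma sum_restrict l (P Q : pred (vertex d)) : subpred Q P ->
  (forall v, P v -> ~~ Q v -> chowC v * mon l = 0) ->
  \sum_(v | Q v) chowC v * mon l = \sum_(v | P v) chowC v * mon l.
Proof.
move=> QP zero; rewrite [RHS](bigID Q) /= [X in _ + X]big1 ?addr0.
  by apply: eq_bigl => v; case Qv: (Q v); rewrite ?andbF ?andbT ?QP.
by move=> v /andP[]; apply: zero.
Qed.

(** Rank of the lower bound for vertices inserted after [pre]: the last vertex with one more
    coordinate set, or the bottom vertex. The form with [last] is the one that [weight_cat]
    produces. *)
Definition end_rank pre := last 0%N [seq (vabs a.1).+1 | a <- pre].

(** Dually, the rank of the upper bound for vertices inserted before [post]: its first vertex with
    one coordinate cleared, or the top vertex. *)
Definition start_rank post := if post is a :: _ then (vabs a.1).-1 else d.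

Lemma chain_cat s1 u s2 : sorted (@vlt d) (s1 ++ u :: s2) =
  sorted (@vlt d) (rcons s1 u) && sorted (@vlt d) (u :: s2).
Proof. by case: s1 => //= a s1; rewrite cat_path rcons_path /= andbA. Qed.

Definition flip u i : vertex d := [ffun j => (j == i) (+) u j].

Lemma vabs_flip u i : ~~ u i -> vabs (flip u i) = (vabs u).+1.
Proof.
move=> ui; rewrite -[RHS]/(1 + vabs u)%N /vabs.
rewrite (_ : [set j | flip u i j] = i |: [set j | u j]).
  by rewrite cardsU1 inE ui.
by apply/setP => j; rewrite !inE ffunE; case: eqP => [->|] //.
Qed.

Lemma flipK i : involutive (flip^~ i).
Proof. by move=> u; apply/ffunP => j; rewrite !ffunE addKb. Qed.

(** Turns the coordinate condition of (R3) into an order condition, so that the vertices to insert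
    form an interval and can be counted. *)
Lemma vle_flip u v i : ~~ u i -> vle (flip u i) v = vle u v && v i.
Proof.
move=> ui; apply/vleP/andP => [le|[/vleP uv vi] j]; rewrite ?ffunE.
  split; last by apply: le; rewrite ffunE eqxx (negbTE ui).
  apply/vleP => j uj; apply: le; rewrite ffunE uj.
  by case: eqP ui => // <-; rewrite uj.
by case: eqP => [->|_ /uv].
Qed.

Lemma vle_flipr u v i : u i -> vle v (flip u i) = vle v u && ~~ v i.
Proof.
move=> ui; apply/vleP/andP => [le|[/vleP vu vi] j]; rewrite ?ffunE.
  split; first by apply/vleP => j /le; rewrite ffunE; case: eqP => // ->.
  by apply/negP => /le; rewrite ffunE eqxx ui.
by case: eqP => [->|_ /vu //]; rewrite (negbTE vi).
Qed.

(** Here [p] is the preceding vertex with a coordinate of [u] added, or the bottom vertex if [pre]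
    is empty. In the sum of (R3) over v_i = 1, or of (R2), terms incomparable to [u] or to the
    predecessor vanish, and v_i = 1 rules out vertices below the predecessor. All terms above [u]
    are kept; [mon_reduce] disposes of them. *)
Lemma below_relation pre u e post :
  let l := pre ++ (u, e) :: post in chain l ->
  exists p, [/\ vle p u, vabs p = end_rank pre,
    forall v, vle p v -> vlt v u -> chain (pre ++ (v, 0%N) :: (u, e) :: post)
  & \sum_(v | vle u v || vle p v && vlt v u) chowC v * mon l = 0].
Proof.
move=> l; rewrite /l; case/lastP: pre @l => [|pre [p f]] l.
  rewrite /chain /= => path_u; exists [ffun=> false]; split.
  - by apply/vleP => i; rewrite ffunE.
  - by rewrite /vabs /end_rank /=; apply/eqP; rewrite cards_eq0;
       apply/eqP/setP => i; rewrite !inE ffunE.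
  - by move=> v _ ->.
  have ul : u \in verts l by rewrite inE eqxx.
  rewrite -[RHS](mon_sum ul); apply: sum_restrict => // v _ /norP[uv].
  rewrite vltE uv andbT negb_and => vu; apply: mon_incomparable ul uv _.
  by case/orP: vu => //; case/vleP => i; rewrite ffunE.
rewrite /chain /verts map_cat map_rcons /= cat_rcons chain_cat.
rewrite [X in _ && X]/= => /and3P[ch pu path_u].
have [i pi ui] := vlt_coord pu.
have pu' : vle (flip p i) u by rewrite vle_flip // ui vltW.
exists (flip p i); split=> //.
- by rewrite vabs_flip // /end_rank map_rcons last_rcons.
- move=> v pv vu; rewrite map_cat map_rcons /= cat_rcons chain_cat ch /=.
  rewrite vu path_u !andbT.
  by move: pv; rewrite vle_flip // vltE => /andP[-> /= vi]; apply: contra pi => /vleP; apply.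
have ul : u \in verts l by rewrite /l /verts map_cat mem_cat inE eqxx orbT.
have pl : p \in verts l.
  by rewrite /l /verts map_cat map_rcons mem_cat mem_rcons inE eqxx.
have neq : u i != p i by rewrite ui (negbTE pi).
rewrite -[RHS](mon_coord_sum true ul pl neq); apply: sum_restrict => v /=.
  rewrite eqb_id vle_flip // => /orP[/vleP|/andP[/andP[]//]]; exact.
rewrite eqb_id vltE vle_flip // => vi /norP[uv]; rewrite vi uv !andbT negb_and.
case/orP=> [pv|vu]; last exact: mon_incomparable ul uv vu.
by apply: mon_incomparable pl pv _; apply: contra pi => /vleP; apply.
Qed.

(** Mirror image of [below_relation]: a coordinate of the next vertex is cleared and the sum runs
    over v_i = 0. *)
Lemma above_relation pre u e post :
  let l := pre ++ (u, e) :: post in chain l ->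
  exists q, [/\ vle u q, vabs q = start_rank post,
    forall v, vlt u v -> vle v q -> chain (pre ++ (u, e) :: (v, 0%N) :: post)
  & \sum_(v | vle v u || vlt u v && vle v q) chowC v * mon l = 0].
Proof.
move=> l; rewrite /l /chain /verts map_cat chain_cat.
case: post @l => [|[q f] post] l.
  move=> /andP[ch _]; exists [ffun=> true]; split.
  - by apply/vleP => i; rewrite ffunE.
  - rewrite /vabs /start_rank -[RHS](card_ord d) -cardsT; congr #|pred_of_set _|.
    by apply/setP => i; rewrite !inE ffunE.
  - by move=> v uv _; rewrite map_cat chain_cat ch /= uv.
  have ul : u \in verts l by rewrite /l /verts map_cat mem_cat inE eqxx orbT.
  rewrite -[RHS](mon_sum ul); apply: sum_restrict => // v _ /norP[vu].
  rewrite vltE vu andbT negb_and => uv; apply: mon_incomparable ul _ vu.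
  by case/orP: uv => //; case/vleP => i; rewrite ffunE.
rewrite [X in _ && X]/= => /and3P[ch uq path_q].
have [i ui qi] := vlt_coord uq.
have uq' : vle u (flip q i) by rewrite vle_flipr // ui vltW.
exists (flip q i); split=> //.
- by rewrite /start_rank -[in RHS](flipK i q) /= [in RHS]vabs_flip // ffunE eqxx qi.
- move=> v uv; rewrite vle_flipr // map_cat chain_cat ch /= uv path_q !andbT /=.
  by rewrite vltE => /andP[-> vi]; apply: contra vi => /vleP; apply.
have ul : u \in verts l by rewrite /l /verts map_cat mem_cat inE eqxx orbT.
have ql : q \in verts l.
  by rewrite /l /verts map_cat mem_cat !inE eqxx !orbT.
have neq : u i != q i by rewrite qi (negbTE ui).
rewrite -[RHS](mon_coord_sum false ul ql neq); apply: sum_restrict => v /=.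
  rewrite eqbF_neg vle_flipr // => /orP[/vleP vu|/and3P[]//].
  by apply: contra ui; apply: vu.
rewrite eqbF_neg vltE vle_flipr // => vi /norP[vu]; rewrite vi vu !andbT negb_and.
case/orP=> [uv|vq]; first exact: mon_incomparable ul uv vu.
by apply: mon_incomparable ql _ vq; apply: contra vi => /vleP; apply.
Qed.

End Monomials.


(** * The product of binomials as a recursive weight *)

Section Weights.
Variable d : nat.
Implicit Types (u v w : vertex d) (l pre post : seq (vertex d * nat)).

(* [r] is one more than the rank of the preceding vertex ([0] if there is none)
   and [s] is the sum of the preceding exponents, so that in the notation of the
   theorem [s - r] is [x], [vabs v - s] is [y] and [vabs v - r] is [x + y].  The
   boolean factor guards against truncated subtraction. *)
Fixpoint weight (r s : nat) l : nat :=
  if l is a :: l' then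
    ((r <= s) * 'C(vabs a.1 - r, s - r) * 'C(a.2, vabs a.1 - s)
     * weight (vabs a.1).+1 (s + a.2.+1) l')%N
  else ((r <= s) * 'C(d.+1 - r, s - r))%N.

Lemma weight_cons r s a l : weight r s (a :: l) =
  ((r <= s) * 'C(vabs a.1 - r, s - r) * 'C(a.2, vabs a.1 - s)
   * weight (vabs a.1).+1 (s + a.2.+1) l)%N.
Proof. by []. Qed.

(** Lists sharing the prefix [pre] get the same factor [A] and enter the rest in the same state, so
    weights need to be compared only from the point of insertion on. *)
Lemma weight_cat pre r s : exists A s', forall l,
  weight r s (pre ++ l)
    = (A * weight (last r [seq (vabs a.1).+1 | a <- pre]) s' l)%N.
Proof.
elim: pre r s => [|a pre IH] r s /=; first by exists 1%N, s => l; rewrite mul1n.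
have [A [s' eqA]] := IH (vabs a.1).+1 (s + a.2.+1)%N.
by eexists _, s' => l; rewrite eqA mulnA.
Qed.

Lemma bin_small_rank a s r : (r <= a < s)%N -> 'C(a - r, s - r) = 0%N.
Proof. by move=> ras; apply: bin_small; lia. Qed.

(** Only vertices of rank [s] contribute: a smaller rank makes the binomial before [v] vanish, a
    larger one makes ['C(0, vabs v - s)] vanish. *)
Lemma weight_below u e post p r s :
  vle p u -> vabs p = r ->
  (\sum_(v | vle p v && vlt v u) weight r s [:: (v, 0), (u, e) & post]
    = (s < vabs u) * ((r <= s) * 'C(vabs u - r, s - r) * 'C(e, vabs u - s.+1)
      * weight (vabs u).+1 (s + e.+2) post))%N.
Proof.
move=> pu pr.
rewrite (bigID (fun v => vabs v == s)) /= [X in (_ + X)%N]big1 ?addn0; last first.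
  move=> v /andP[/andP[/vabs_le pv _] vs].
  have [sr|rs] := ltnP s r; first by rewrite !mul0n.
  have [vs'|] := ltnP (vabs v) s.
    by rewrite bin_small_rank ?muln0 ?mul0n // -pr pv.
  rewrite leq_eqVlt eq_sym (negbTE vs) /= => sv.
  by rewrite [X in (_ * X * _)%N]bin_small ?muln0 ?mul0n // subn_gt0.
set X := (X in _ = (_ * X)%N).
(* At rank [s] the state after [v] is (s+1, s+1), so the binomials next to [v] are all 1. The
   summand is then constant and the sum becomes a count. *)
rewrite (eq_bigr (fun=> ((r <= s) * ('C(e, vabs u - s.+1)
  * weight (vabs u).+1 (s + e.+2) post))%N)); last first.
  move=> v /andP[_ /eqP ->].
  by rewrite !binn !subnn bin0 addn1 ltnSn subnn bin0 !mul1n !muln1 addSnnS.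
rewrite sum_nat_const /X (eq_card (B := [set v | [&& vle p v, vlt v u & vabs v == s]])).
  2: by move=> v; rewrite !inE andbA.
rewrite card_below // pr.
by case: (leqP r s) => // _; case: (ltnP s) => // _; rewrite !mul1n mulnA.
Qed.

(** In the state (s+1, s+1) left by an inserted vertex of rank [s] the next binomial is 1; the
    number of such vertices supplies exactly the missing binomial. *)
Lemma weight_start u post s : (vabs u <= s)%N ->
  ('C(start_rank post - vabs u, s - vabs u) * weight s.+1 s.+1 post
    = weight (vabs u).+1 s.+1 post)%N.
Proof.
move=> us; case: post => [|[q t] post] /=.
  by rewrite leqnn ltnS us subnn bin0 !mul1n muln1 !subSS.
by rewrite leqnn ltnS us subnn bin0 !mul1n !mulnA subSS; congr ('C(_, _) * _ * _)%N; lia.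
Qed.

Lemma weight_above u post q s :
  vle u q -> vabs q = start_rank post ->
  (\sum_(v | vlt u v && vle v q) weight (vabs u).+1 s ((v, 0) :: post)
    = (vabs u < s) * weight (vabs u).+1 s.+1 post)%N.
Proof.
move=> uq qr.
have [us|su] := ltnP (vabs u) s; last first.
  by rewrite big1 // => v _ /=; rewrite ltnNge su.
rewrite (bigID (fun v => vabs v == s)) /= [X in (_ + X)%N]big1 ?addn0; last first.
  move=> v /andP[/andP[/vabs_lt uv _] vs].
  have [vs'|] := ltnP (vabs v) s.
    by rewrite bin_small_rank ?muln0 ?mul0n // uv.
  rewrite leq_eqVlt eq_sym (negbTE vs) /= => sv.
  by rewrite [X in (_ * X * _)%N]bin_small ?muln0 ?mul0n // subn_gt0.
rewrite (eq_bigr (fun=> weight s.+1 s.+1 post)); last first.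
  by move=> v /andP[_ /eqP ->]; rewrite binn subnn bin0 us addn1 !mul1n.
rewrite sum_nat_const (eq_card (B := [set v | [&& vlt u v, vle v q & vabs v == s]])).
  2: by move=> v; rewrite !inE andbA.
by rewrite card_above // qr mul1n weight_start // ltnW.
Qed.

(* Summing over the inserted vertices turns the statement into Pascal's rule. *)
Lemma weight_insert pre u e post p q :
  vle p u -> vabs p = end_rank pre -> vle u q -> vabs q = start_rank post ->
  (\sum_(v | vle p v && vlt v u) weight 0 0 (pre ++ [:: (v, 0), (u, e) & post])
   + \sum_(v | vlt u v && vle v q) weight 0 0 (pre ++ [:: (u, e), (v, 0) & post])
   = weight 0 0 (pre ++ (u, e.+1) :: post))%N.
Proof.
move=> pu pr uq qr; have [A [s eqA]] := weight_cat pre 0 0; rewrite -/(end_rank pre) in eqA.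
rewrite !(eq_bigr _ (fun v _ => eqA _)) eqA -2!big_distrr -mulnDr; congr muln.
rewrite weight_below // (eq_bigr _ (fun v _ => weight_cons _ _ (u, e) ((v, 0%N) :: post))).
rewrite -big_distrr /= weight_above // -pr !addnS ltnS.
move: (weight _ _ post) => W.
have [rs|_] := leqP (vabs p) s; last by rewrite !mul0n muln0.
(* For |u| < s every term vanishes; for s < |u| this is Pascal's rule; for |u| = s nothing is
   inserted below and the second sum alone gives the result. *)
have [us|us|<-] := ltngtP (vabs u) s; rewrite ?mul0n ?add0n ?mul1n.
- by rewrite bin_small_rank ?mul0n // us vabs_le.
- have -> : (vabs u - s = (vabs u - s.+1).+1)%N by lia.
  rewrite binS; have [ue|ue] := leqP (vabs u) (s + e); first by nia.
  (* Here the guard of the second sum fails, in agreement with the vanishing of its binomial. *)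
  by rewrite (bin_small (n := e) (m := _.+1)); [nia | lia].
by rewrite subnn !bin0 leq_addr !mul1n.
Qed.

Lemma rank_bound r (s : seq nat) n :
  path ltn r s -> all (leq^~ n) (r :: s) -> (r + size s <= n)%N.
Proof.
elim: s r => [|a s IH] r /=; first by rewrite addn0 andbT.
move=> /andP[ra path_s] /andP[_ le_s].
by apply: leq_trans (IH a path_s le_s); rewrite addnS -addSn leq_add2r.
Qed.

(** The d+1-r remaining ranks increase strictly between [r] and [d], so they take every value; the
    first is [r] itself and each binomial is 1. *)
Lemma weight_maximal_from r l : all (fun a => a.2 == 0%N) l ->
  path ltn r [seq (vabs a.1).+1 | a <- l] -> (r + size l = d.+1)%N ->
  weight r r l = 1%N.
Proof.
elim: l r => [|[u e] l IH] r /=.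
  by move=> _ _; rewrite addn0 leqnn !subnn => ->; rewrite bin0.
move=> /andP[/eqP-> l0] /andP[ru path_l] sz.
have := rank_bound path_l (n := d.+1).
rewrite size_map /= ltnS vabs_max all_map => /(_ _)/wrap[].
  by apply/allP => a _ /=; rewrite ltnS vabs_max.
move=> ub; have ur : vabs u = r by lia.
by rewrite ur leqnn subnn bin0 addn1 !mul1n IH -?ur //; lia.
Qed.

Lemma weight_maximal l : all (fun a => a.2 == 0%N) l -> chain l ->
  size l = d.+1 -> weight 0 0 l = 1%N.
Proof.
move=> l0 ch sz; apply: weight_maximal_from => //.
case: l ch {l0 sz} => //= a l; rewrite /chain /verts /= !path_map.
by apply: sub_path => b c /=; apply: vabs_lt.
Qed.

End Weights.


(** * Reduction of monomials to maximal chains, and the degree *)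

Section Reduction.
Variable d : nat.
Implicit Types (u v : vertex d) (l pre post : seq (vertex d * nat)).

(** The identities for monomials and for weights are bundled because both must range over the same
    inserted vertices, which depend on the choice of [p] and [q]. *)
Lemma mon_reduce pre u e post : chain (pre ++ (u, e) :: post) ->
  exists p q : vertex d,
  [/\ mon (pre ++ (u, e.+1) :: post)
      = - (\sum_(v | vle p v && vlt v u) mon (pre ++ [:: (v, 0), (u, e) & post])
         + \sum_(v | vlt u v && vle v q) mon (pre ++ [:: (u, e), (v, 0) & post])),
    forall v, vle p v && vlt v u -> chain (pre ++ [:: (v, 0), (u, e) & post]),
    forall v, vlt u v && vle v q -> chain (pre ++ [:: (u, e), (v, 0) & post])
  & (\sum_(v | vle p v && vlt v u) weight 0 0 (pre ++ [:: (v, 0), (u, e) & post])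
     + \sum_(v | vlt u v && vle v q) weight 0 0 (pre ++ [:: (u, e), (v, 0) & post])
     = weight 0 0 (pre ++ (u, e.+1) :: post))]%N.
Proof.
move=> ch.
have [p [pu pr chp relp]] := below_relation ch.
have [q [uq qr chq relq]] := above_relation ch.
exists p, q; split; last exact: weight_insert.
- set l := pre ++ (u, e) :: post in ch relp relq *.
  have ul : u \in verts l by rewrite /l /verts map_cat mem_cat inE eqxx orbT.
  have relu : \sum_(v | vle u v || vle v u) chowC v * mon l = 0.
    rewrite -[RHS](mon_sum ul); apply: sum_restrict => // v _ /norP[uv vu].
    exact: mon_incomparable ul uv vu.
  have -> : mon (pre ++ (u, e.+1) :: post) = chowC u * mon l.
    by rewrite !mon_cat !mon_cons /= (exprS _ e.+1) -mulrA mulrCA.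
  rewrite (eq_bigr (fun v => chowC v * mon l)); last by move=> v _; rewrite mon_insert.
  rewrite [X in _ + X](eq_bigr (fun v => chowC v * mon l)); last first.
    by move=> v _; rewrite -cat_rcons -mon_insert cat_rcons.
  apply/eqP; rewrite -subr_eq0 opprK; apply/eqP.
  have <- : \sum_(v | v == u) chowC v * mon l = chowC u * mon l by rewrite big_pred1_eq.
  (* Inclusion-exclusion: a vertex above or below [u] outside the two intervals cancels against the
     last sum, and [u] itself is counted 1 + 1 - 1 times. *)
  transitivity (\sum_(v | vle u v || vle p v && vlt v u) chowC v * mon l
    + \sum_(v | vle v u || vlt u v && vle v q) chowC v * mon l
    - \sum_(v | vle u v || vle v u) chowC v * mon l); last first.
    by rewrite relp relq relu addr0 subr0.
  have mkcond P : \sum_(v | P v) chowC v * mon l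
      = \sum_(v <- enum {: vertex d}) if P v then chowC v * mon l else 0.
    by rewrite big_mkcond big_enum.
  rewrite !mkcond -sumrN -!big_split /=.
  apply: eq_bigr => v _.
  rewrite !vltE.
  case: (eqVneq v u) => [->|neq]; first by rewrite vle_refl /= !andbF; ring.
  have: ~~ (vle u v && vle v u).
    by apply: contra neq => /andP[uv vu]; apply/eqP/vle_anti.
  case: (vle u v); case: (vle v u) => //= _; rewrite ?andbT ?andbF; try by ring.
- by move=> v /andP[]; apply: chp.
- by move=> v /andP[]; apply: chq.
Qed.

(** Records an expansion into maximal chains, with repetitions: an empty one proves vanishing in the
    ring without a degree map, and its length gives the degree. *)
Definition simplex_sum (x : chow d) (w : nat) : Prop :=
  exists T : seq (seq (vertex d)), [/\ all (@nondeg_simplex d d) T, size T = w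
    & x = \sum_(t <- T) \prod_(v <- t) chowC v].

Lemma simplex_sum0 : simplex_sum 0 0.
Proof. by exists [::]; rewrite big_nil. Qed.

Lemma simplex_sumD x1 w1 x2 w2 : simplex_sum x1 w1 -> simplex_sum x2 w2 ->
  simplex_sum (x1 + x2) (w1 + w2).
Proof.
move=> [T1 [all1 <- ->]] [T2 [all2 <- ->]]; exists (T1 ++ T2).
by rewrite all_cat all1 all2 size_cat big_cat.
Qed.

Lemma simplex_sum_big (P : pred (vertex d)) F G :
  (forall v, P v -> simplex_sum (F v) (G v)) ->
  simplex_sum (\sum_(v | P v) F v) (\sum_(v : vertex d | P v) G v)%N.
Proof.
move=> FG; apply: (big_ind2 simplex_sum) => //; first exact: simplex_sum0.
exact: simplex_sumD.
Qed.

(** Induction on the sum of the stored exponents: each reduction lowers it by one, changes the sign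
    and keeps the total degree. At zero the chain has d+1 vertices and is maximal. *)
Lemma mon_weight l : chain l -> (\sum_(a <- l) a.2.+1 = d.+1)%N ->
  simplex_sum ((-1) ^+ (\sum_(a <- l) a.2)%N * mon l) (weight 0 0 l).
Proof.
have [E] := ubnP (\sum_(a <- l) a.2)%N; elim: E l => // E IH l lE ch tot.
have [l0|] := boolP (all (fun a => a.2 == 0%N) l).
  have z : (\sum_(a <- l) a.2 = 0)%N by rewrite big_seq big1 // => a /(allP l0)/eqP.
  have sz : size l = d.+1.
    rewrite -tot -sum1_size; apply: eq_big_seq => a /(allP l0)/eqP-> //.
  rewrite z mul1r weight_maximal //; exists [:: verts l]; split=> //.
    by rewrite /= andbT /nondeg_simplex size_map sz eqxx.
  rewrite big_seq1 big_map; apply: eq_big_seq => a /(allP l0)/eqP->.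
  by rewrite expr1.
case/allPn=> [[u [//|e]] ul _].
case/splitPr: ul lE ch tot => pre post lE ch tot.
have [|p [q [-> chp chq <-]]] := @mon_reduce pre u e post.
  by move: ch; rewrite /chain /verts !map_cat.
have eqE v l' : perm_eq l' [:: (v, 0%N), (u, e) & pre ++ post] ->
    (\sum_(a <- pre ++ (u, e.+1) :: post) a.2 = (\sum_(a <- l') a.2).+1)%N /\
    (\sum_(a <- l') a.2.+1 = d.+1)%N.
  move=> pl; rewrite -tot !(perm_big _ pl) !big_cat !big_cons /= !big_cat /=.
  by split; [rewrite add0n addSn addnS addnCA | rewrite [RHS]addnCA].
rewrite mulrN -mulNr mulrDr !mulr_sumr; apply: simplex_sumD; apply: simplex_sum_big => v cond.
  have [] := eqE v (pre ++ [:: (v, 0%N), (u, e) & post]).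
    by rewrite (perm_catCA pre [:: (v, 0%N); (u, e)] post).
  move=> eq1 eq2; rewrite eq1 exprS mulN1r opprK; apply: IH => //; last exact: chp.
  by rewrite eq1 in lE.
have [] := eqE v (pre ++ [:: (u, e), (v, 0%N) & post]).
  rewrite (perm_catCA pre [:: (u, e); (v, 0%N)] post).
  by rewrite (perm_catCA [:: (u, e)] [:: (v, 0%N)]).
move=> eq1 eq2; rewrite eq1 exprS mulN1r opprK; apply: IH => //; last exact: chq.
by rewrite eq1 in lE.
Qed.

Lemma chow_piece_prod (t : seq (vertex d)) :
  chow_piece (size t) (\prod_(v <- t) chowC v).
Proof.
exists (\prod_(v <- t) cvar v); last by rewrite chow_pi_prod.
elim: t => [|v t IH]; first by rewrite big_nil dhomog1.
rewrite big_cons; rewrite -[(size _)]add1n; apply: dhomogM => //.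
by rewrite dhomogX; apply/eqP/mdeg1.
Qed.

Lemma chow_piece_sum m (T : seq (seq (vertex d))) :
  all (fun t => size t == m) T ->
  chow_piece m (\sum_(t <- T) \prod_(v <- t) chowC v).
Proof.
elim: T => [_|t T IH /= /andP[/eqP st /IH [p hp eqp]]].
  by exists 0; rewrite ?big_nil ?chow_pi0 ?dhomog0.
have [r hr eqr] := chow_piece_prod t; exists (r + p).
  by apply: dhomogD => //; rewrite -st.
by rewrite big_cons eqp eqr chow_piD.
Qed.

Lemma degree_simplex_sum deg x w : is_degree_map deg -> simplex_sum x w ->
  deg x = w%:Z.
Proof.
move=> isdeg [T [allT <- ->]].
have deg0 : deg 0 = 0.
  have p0 : chow_piece d.+1 (0 : chow d) by exists 0; rewrite ?chow_pi0 ?dhomog0.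
  by apply: (addIr (deg 0)); rewrite -(deg_add isdeg) // addr0 add0r.
elim: T allT => [|t T IH] /=; first by rewrite big_nil.
case/andP=> nt allT; have piece_T : all (fun t => size t == d.+1) (t :: T).
  by apply/allP => s; rewrite inE => /predU1P[->|/(allP allT)]; [case/andP: nt|case/andP].
rewrite big_cons (deg_add isdeg).
- by rewrite (deg_maxchain isdeg) // IH // -PoszD.
- by case/andP: nt => /eqP<- _; apply: chow_piece_prod.
- by case/andP: piece_T => _; apply: chow_piece_sum.
Qed.

(** Additivity of [deg] is available only on the graded piece, so [x] is first shown to lie there;
    then x + (-x) = 0 moves the sign outside. *)
Lemma degree_sign deg e (x : chow d) w : is_degree_map deg ->
  simplex_sum ((-1) ^+ e * x) w -> deg x = (-1) ^+ e * w%:Z.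
Proof.
move=> isdeg xw; have dx := degree_simplex_sum isdeg xw.
rewrite -signr_odd in xw dx; rewrite -signr_odd; case: (odd e) xw dx => /=;
  last by rewrite expr0 !mul1r.
rewrite expr1 !mulN1r => xw dx.
have piece y w' : simplex_sum y w' -> chow_piece d.+1 y.
  by case=> T [/allP allT _ ->]; apply: chow_piece_sum; apply/allP => t /allT /andP[].
have piece_x : chow_piece d.+1 x.
  have [p hp eqp] := piece _ _ xw; exists (- p); first by rewrite dhomogN.
  by rewrite chow_piN -eqp opprK.
apply: (addIr (deg (- x))); rewrite -(deg_add isdeg) //; last exact: piece _ _ xw.
by rewrite subrr dx addNr (degree_simplex_sum isdeg simplex_sum0).
Qed.

End Reduction.


(** * From lists to the indexed families of the theorem *)

Section Indexed.
Variables (d : nat) (v : nat -> vertex d) (n : nat -> nat).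

(** [prev_rank] and [prev_sum] are the arguments [r] and [s] of [weight] on reaching index [i];
    index 1 has no predecessor and starts at 0. *)
Definition prev_rank (i : nat) : nat :=
  if i is j.+2 then (vabs (v j.+1)).+1 else 0%N.

Definition prev_sum (i : nat) : nat := (\sum_(1 <= j < i) n j)%N.

Lemma weight_iota i k : (0 < i)%N ->
  (forall j, (i <= j < i + k)%N -> (1 <= n j)%N) ->
  weight (prev_rank i) (prev_sum i) [seq (v j, (n j).-1) | j <- iota i k]
  = (\prod_(i <= j < i + k)
       ((prev_rank j <= prev_sum j)
        * 'C(vabs (v j) - prev_rank j, prev_sum j - prev_rank j)
        * 'C((n j).-1, vabs (v j) - prev_sum j))
     * ((prev_rank (i + k) <= prev_sum (i + k))
        * 'C(d.+1 - prev_rank (i + k), prev_sum (i + k) - prev_rank (i + k))))%N.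
Proof.
elim: k i => [|k IH] i i0 n1; first by rewrite addn0 big_geq // mul1n.
rewrite /= prednK; last by apply: n1; lia.
have <- : prev_sum i.+1 = (prev_sum i + n i)%N by rewrite /prev_sum big_nat_recr.
have <- : prev_rank i.+1 = (vabs (v i)).+1 by case: i i0 {n1}.
rewrite IH //; last by move=> j ij; apply: n1; lia.
by rewrite addSnnS [in RHS]big_ltn ?mulnA //; lia.
Qed.

Lemma chain_iota i k :
  (forall j, (i <= j < i + k)%N -> vlt (v j) (v j.+1)) ->
  chain [seq (v j, (n j).-1) | j <- iota i k.+1].
Proof.
rewrite /chain /verts -map_comp /=.
elim: k i => //= k IH i H; rewrite H /=; last by lia.
by apply: IH => j ij; apply: H; lia.
Qed.

End Indexed.

(* The families v, n, y, x are indexed by nat as in the text; only v 1, ..., v k,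
   n 1, ..., n k, y 0, ..., y (k-1) and x 1, ..., x k are relevant. *)
Theorem theorem1p6 (d k : nat) (v : nat -> vertex d) (n : nat -> nat)
    (d_ge1 : (1 <= d)%N)
    (v_chain : forall i, (1 <= i < k)%N -> vlt (v i) (v i.+1))
    (n_ge1 : forall i, (1 <= i <= k)%N -> (1 <= n i)%N)
    (n_sum : (\sum_(1 <= i < k.+1) n i = d.+1)%N) :
  let Csigma : chow d := \prod_(1 <= i < k.+1) chowC (v i) ^+ n i in
  let left_case :=
    exists2 i, (1 <= i < k)%N &
      (\sum_(1 <= j < i.+1) n j > vabs (v i.+1))%N in
  let right_case :=
    exists2 i, (2 <= i <= k)%N &
      (\sum_(i <= j < k.+1) n j > d - vabs (v i.-1))%N in
  [/\ left_case -> Csigma = 0,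
      right_case -> Csigma = 0
    & ~ left_case -> ~ right_case ->
      exists y x : nat -> nat,
        [/\ vabs (v 1%N) = y 0%N,
            forall i, (2 <= i <= k)%N ->
              vabs (v i) = (vabs (v i.-1) + x i.-1 + y i.-1 + 1)%N,
            forall i, (1 <= i <= k)%N -> n i = (y i.-1 + x i + 1)%N
          & forall deg : chow d -> int, is_degree_map deg ->
              deg Csigma =
                (-1) ^+ (d.+1 - k) *
                ((\prod_(1 <= i < k)
                    ('C(y i.-1 + x i, y i.-1) * 'C(x i + y i, x i)))
                 * 'C(y k.-1 + x k, x k))%N%:Z]].
Proof.
move=> Csigma left_case right_case.
have k0 : (0 < k)%N.
  by case: k n_sum {v_chain n_ge1 Csigma left_case right_case} => //; rewrite big_geq.
pose l := [seq (v i, (n i).-1) | i <- iota 1 k].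
have iotaE : index_iota 1 k.+1 = iota 1 k by rewrite /index_iota subSS subn0.
have monl : mon l = Csigma.
  rewrite /mon big_map -iotaE; apply: eq_big_nat => i ik /=.
  by rewrite prednK // n_ge1.
have tot : (\sum_(a <- l) a.2.+1 = d.+1)%N.
  rewrite big_map -iotaE -n_sum; apply: eq_big_nat => i ik /=.
  by rewrite prednK // n_ge1.
have sign : (\sum_(a <- l) a.2 = d.+1 - k)%N.
  rewrite -tot -[k in RHS](size_iota 1 k) -(size_map (fun i => (v i, (n i).-1))).
  rewrite -/l -sum1_size -(eq_bigr _ (fun a _ => addn1 a.2)) big_split /= addnK.
  by [].
have ch : chain l.
  rewrite /l -(prednK k0); apply: chain_iota => i ik; apply: v_chain; lia.
have := mon_weight ch tot; rewrite sign monl => simpl_sum.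
(* An empty expansion makes the signed monomial zero, and the sign is invertible. *)
have vanish : weight 0 0 l = 0%N -> Csigma = 0.
  move=> w0; move: simpl_sum; rewrite w0 => -[T [_ /size0nil -> ]].
  by rewrite big_nil => /(congr1 ( *%R ((-1) ^+ (d.+1 - k)))); rewrite signrMK mulr0.
have prev_sum_k : prev_sum n k.+1 = d.+1 by [].
have prev_sumE i : (1 <= i <= k.+1)%N ->
    (prev_sum n i + \sum_(i <= j < k.+1) n j = d.+1)%N.
  by case/andP=> i1 ik; rewrite -n_sum /prev_sum -big_cat_nat.
have last_rank : prev_rank v k.+1 = (vabs (v k)).+1 by case: (k) k0.
have wE : weight 0 0 l = (\prod_(1 <= j < k.+1)
       ((prev_rank v j <= prev_sum n j)
        * 'C(vabs (v j) - prev_rank v j, prev_sum n j - prev_rank v j)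
        * 'C((n j).-1, vabs (v j) - prev_sum n j)))%N.
  have := @weight_iota d v n 1 k isT; rewrite add1n last_rank prev_sum_k.
  rewrite {1}/prev_sum big_geq // => ->; last by move=> j; apply: n_ge1.
  (* Both entries of the closing binomial equal d - |v_k|. *)
  by rewrite ltnS vabs_max binn !muln1.
have zero j : (1 <= j <= k)%N ->
    ((prev_rank v j <= prev_sum n j)
        * 'C(vabs (v j) - prev_rank v j, prev_sum n j - prev_rank v j) = 0)%N ->
    weight 0 0 l = 0%N.
  case/andP=> j1 jk j0; rewrite wE (big_cat_nat (n := j)) //=; last exact: leqW.
  by rewrite [X in (_ * X)%N]big_ltn // j0 mul0n muln0.
have lt_rank i : (1 <= i < k)%N -> (vabs (v i) < vabs (v i.+1))%N.
  by move/v_chain/vabs_lt.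
split.
(* The binomial before v_{i+1} has its lower entry larger than its upper one. *)
- case=> i ik lt; apply/vanish/(zero i.+1); first lia.
  have := lt_rank i ik; case: i ik lt => // i ik lt r.
  by rewrite /prev_sum bin_small_rank ?muln0 //= lt r.
(* As the exponents add up to d+1, those before [i] sum to at most |v_{i-1}|, so the guard at [i]
   fails. *)
- case=> [[|[|i]]] // ik lt; apply/vanish/(zero i.+2) => //.
  have -> : (prev_rank v i.+2 <= prev_sum n i.+2)%N = false; last by rewrite !mul0n.
  apply/negbTE; rewrite -ltnNge /=.
  have := prev_sumE i.+2; have := vabs_max (v i.+1); move: lt; rewrite /=; lia.
move=> no_left no_right.
have left i : (1 <= i <= k)%N -> (prev_sum n i <= vabs (v i))%N.
  case: i => [|[|i]] // ik; first by rewrite /prev_sum big_geq.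
  by rewrite leqNgt; apply/negP => lt; apply: no_left; exists i.+1.
have right i : (1 <= i <= k.+1)%N -> (prev_rank v i <= prev_sum n i)%N.
  move=> ik; have := prev_sumE i ik; case: i ik => [|[|i]] //= ik sumE.
  have [eqk|nek] := eqVneq i.+1 k.
    by rewrite eqk prev_sum_k ltnS vabs_max.
  rewrite leqNgt; apply/negP => lt; apply: no_right; exists i.+2; first by lia.
  by have := vabs_max (v i.+1); rewrite /=; lia.
(* With S_i = n_1 + ... + n_i these are y_i = |v_{i+1}| - S_i and x_i = S_i - |v_i| - 1; [left] and
   [right] make the relevant subtractions exact. *)
pose y i := (vabs (v i.+1) - prev_sum n i.+1)%N.
pose x i := (prev_sum n i.+1 - (vabs (v i)).+1)%N.
have prev_sumS i : (1 <= i)%N -> prev_sum n i.+1 = (prev_sum n i + n i)%N.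
  by move=> i1; rewrite /prev_sum big_nat_recr.
have nE i : (1 <= i <= k)%N -> n i = (y i.-1 + x i + 1)%N.
  case: i => [|i] // ik; rewrite /x /y /=.
  have := left i.+1 ik; have := right i.+2; have := prev_sumS i.+1 isT.
  have := n_ge1 i.+1 ik; rewrite /=; lia.
exists y, x; split=> //.
- by rewrite /y /prev_sum big_geq ?subn0.
- case=> [|[|i]] // ik; rewrite /x /y /=.
  have := left i.+2 ik; have := right i.+2; rewrite /=; lia.
move=> deg isdeg; rewrite (degree_sign isdeg simpl_sum); congr (_ * Posz _).
(* Symmetry brings the last binomial into the form [B k]. *)
have -> : 'C(y k.-1 + x k, x k) = 'C(y k.-1 + x k, y k.-1).
  by rewrite -[RHS]bin_sub ?leq_addr // addKn.
pose A j := 'C(vabs (v j) - prev_rank v j, prev_sum n j - prev_rank v j).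
pose B j := 'C(y j.-1 + x j, y j.-1).
transitivity (\prod_(1 <= j < k.+1) (A j * B j))%N.
  rewrite wE; apply: eq_big_nat => j; rewrite ltnS => jk.
  rewrite right ?mul1n ?nE ?addn1 //=; last by lia.
  by rewrite /B /A {2 3}/y; case: j jk.
(* The factor [A 1] is 1; shifting the index of the other [A] turns [A i.+1] into the binomial of
   x_i + y_i over x_i. *)
rewrite !big_split /= big_ltn // [X in (_ * X)%N]big_nat_recr //=.
rewrite {1}/A /= /prev_sum big_geq // bin0 mul1n big_add1 /= mulnCA mulnA.
congr (_ * _ * _)%N; apply: eq_big_nat => -[|i] // ik.
have := left i.+2; have := right i.+2; have := lt_rank i.+1 ik.
rewrite /A /x /y /=; move: (prev_sum n i.+2) => s ? r ?; congr 'C(_, _); lia.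
Qed.
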